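(* For every integer $n\ge2$, $\mathrm{J}(\mathbb{R}^n)\subset \mathrm{AC}(\mathbb{R}^n)\setminus\mathrm{D}(\mathbb{R}^n)$. In particular, the class $\mathrm{AC}(\mathbb{R}^n)\setminus \mathrm{D}(\mathbb{R}^n)$ is $2^{\mathfrak{c}}$-spaceable (with respect to the topology of pointwise convergence) and $\mathcal{L}_p(\mathrm{AC}(\mathbb{R}^n)\setminus \mathrm{D}(\mathbb{R}^n))=\left(2^{\mathfrak{c}}\right)^+$.
   Context: $\mathfrak{c}=|\mathbb{R}|$ and $\kappa^+$ is the cardinal successor of $\kappa$. Work in the real vector space $\mathbb{R}^{\mathbb{R}^n}$ of all functions from $\mathbb{R}^n$ to $\mathbb{R}$, with $\tau_p$ the topology of pointwise convergence. $M\subset\mathbb{R}^{\mathbb{R}^n}$ is $\mu$-spaceable with respect to $\tau_p$ if $M\cup\{0\}$ contains a $\tau_p$-closed vector subspace of dimension $\mu$; $\mathcal{L}_p(M)=\min\{\kappa\colon M\cup\{0\}\text{ contains no } \tau_p\text{-closed vector subspace of dimension }\kappa\}$. Classes of functions $f\colon\mathbb{R}^n\to\mathbb{R}$ (a function is identified with its graph): - $\mathrm{J}(\mathbb{R}^n)$ (Jones functions): $f\cap F\neq\varnothing$ for every closed set $F\subset\mathbb{R}^n\times\mathbb{R}$ whose projection on $\mathbb{R}^n$ is uncountable. - $\mathrm{AC}(\mathbb{R}^n)$ (almost continuous): each open subset of $\mathbb{R}^n\times\mathbb{R}$ containing the graph of $f$ contains also the graph of a continuous function from $\mathbb{R}^n$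 to $\mathbb{R}$. - $\mathrm{D}(\mathbb{R}^n)$ (Darboux): $f[K]$ is connected (an interval) for every connected $K\subset\mathbb{R}^n$.
   Formalization: L_p(M) is read as the least κ such that M∪{0} contains no τ_p-closed subspace of dimension at least κ; with ''exactly κ'' the equality fails, since τ_p-closed subspaces never have dimension ℵ_0, so L_p(M) would be at most ℵ_0. *)

(* Defs.v *)
From HB Require Import structures.
From mathcomp Require Import all_boot all_order all_algebra.
From mathcomp Require Import all_classical all_reals all_analysis.
Set Implicit Arguments.
Unset Strict Implicit.
Unset Printing Implicit Defensive.
Import Order.TTheory GRing.Theory Num.Theory.
Import numFieldNormedType.Exports.
Local Open Scope classical_set_scope.
Local Open Scope card_scope.
Local Open Scope ring_scope.

(* A cardinal is represented by any type [K] of that cardinality, compared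
   through [[set: K] #<= [set: L]]. *)

Definition card_lt (K L : Type) : Prop :=
  [set: K] #<= [set: L] /\ ~ ([set: L] #<= [set: K]).

Definition is_succ_card (K L : Type) : Prop :=
  card_lt L K /\ forall C : Type, card_lt L C -> [set: K] #<= [set: C].

Section Dimension.
Variables (R : realType) (E : lmodType R).

Definition lin_indep (B : set E) : Prop :=
  forall (s : seq E) (c : E -> R), uniq s -> {subset s <= B} ->
    \sum_(v <- s) c v *: v = 0 -> forall v, v \in s -> c v = 0.

Definition lin_span (B : set E) : set E :=
  [set v | exists (s : seq E) (c : E -> R),
    {subset s <= B} /\ v = \sum_(w <- s) c w *: w].

Definition hamel_basis (B V : set E) : Prop :=
  lin_indep B /\ lin_span B = V.

Definition has_dim (V : set E) (K : Type) : Prop :=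
  exists2 B : set E, hamel_basis B V & B #= [set: K].

End Dimension.

Section Classes.
Variables (R : realType) (n : nat).
Implicit Types (f : 'rV[R]_n -> R) (M : set ('rV[R]_n -> R)).

Definition Jones : set ('rV[R]_n -> R) :=
  [set f | forall F : set ('rV[R]_n * R), closed F ->
    ~ countable (fst @` F) -> exists x, F (x, f x)].

Definition almost_continuous : set ('rV[R]_n -> R) :=
  [set f | forall U : set ('rV[R]_n * R), open U -> (forall x, U (x, f x)) ->
    exists2 g : 'rV[R]_n -> R, continuous g & forall x, U (x, g x)].

Definition Darboux : set ('rV[R]_n -> R) :=
  [set f | forall K : set 'rV[R]_n, connected K -> connected (f @` K)].

Definition ptws_spaceable M (mu : Type) : Prop :=
  exists V : set ('rV[R]_n -> R),
    [/\ GRing.submod_closed [pred f | f \in V],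
        closed (V : set {ptws 'rV[R]_n -> R}),
        has_dim V mu
      & V `<=` M `|` [set 0]].

(* [kappa = L_p(M)], where "contains no closed subspace of dimension kappa" is
   read "of dimension at least kappa".  The two readings agree for subspaces
   with no topological restriction, but an infinite-dimensional subspace that
   is closed for pointwise convergence has dimension [2 ^ lambda] for some
   infinite [lambda].  Hence no closed subspace at all has dimension [aleph_0],
   and with "exactly kappa" the minimum would never exceed [aleph_0]. *)
Definition no_closed_subspace_from M (kappa : Type) : Prop :=
  forall mu : Type, [set: kappa] #<= [set: mu] -> ~ ptws_spaceable M mu.

Definition is_Lp M (kappa : Type) : Prop :=
  no_closed_subspace_from M kappa /\
  forall K : Type, no_closed_subspace_from M K -> [set: kappa] #<= [set: K].

End Classes.

Arguments Jones : clear implicits.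
Arguments almost_continuous : clear implicits.
Arguments Darboux : clear implicits.

(* Main.v *)
Require Import Defs.
From mathcomp Require Import all_boot all_order all_algebra.
From mathcomp Require Import all_classical all_reals all_analysis.
From mathcomp Require Import ring lra.
Set Implicit Arguments.
Unset Strict Implicit.
Unset Printing Implicit Defensive.
Import Order.TTheory GRing.Theory Num.Theory.
Import numFieldNormedType.Exports.
Local Open Scope classical_set_scope.
Local Open Scope card_scope.
Local Open Scope ring_scope.

(* A Jones function f is almost continuous: the complement F of a neighbourhood
   of its graph has countable projection, so around every point almost every
   sphere misses that projection.  Near such a sphere every value is allowed,
   which makes it possible to glue the local constants f(x) into a continuous
   function avoiding F.

   f is not Darboux: {f <> 0} and its complement meet every uncountable closed
   set, and for n >= 2 no countable closed set separates R^n.  Hence {f <> 0}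
   is connected, while its image is R \ {0}.

   For spaceability, transfinite induction gives e : R^n -> R and a labelling l
   of R^n by the closed subsets of R^n * R (there are 2^aleph_0 of them) such
   that e restricted to each single fiber of l still meets every closed set
   with uncountable projection; this uses that such a projection contains a
   Cantor set.  The functions a(l x) e(x), with a arbitrary, form a closed
   space of Jones functions (and 0).  A finite closed set can record how
   finitely many subsets of R^n differ, which provides 2^c independent
   elements; the upper bound is the cardinality of the space of all functions.

   The successor of 2^c is found, and cardinals are compared, without ordinals,
   by means of Hönig's proof that every family of types has one of minimal
   cardinality. *)

(** * Cardinals *)

Lemma card_leTTP (T U : Type) :
  [set: T] #<= [set: U] <-> exists f : T -> U, injective f.
Proof.
split=> [/card_leP[f]|[f fI]].
  pose tT (x : T) : [set: T] := SigSub (mem_set (I : [set: T] x)).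
  exists (fun x => val (f (tT x))) => x y /val_inj fxy.
  have := 'inj_f (mem_set I) (mem_set I) fxy.
  by move=> /(congr1 val).
elim/Ppointed: U => U in f fI *.
  elim/Ppointed: T => T in f fI *; first by rewrite !emptyE_subdef.
  by case: (no (f point)).
by apply/pcard_injP; exists f => x y _ _; exact: fI.
Qed.

Lemma card_le_setP (T U : Type) (A : set T) :
  A #<= [set: U] -> forall u0 : U, exists f : T -> U, {in A &, injective f}.
Proof.
move=> AU u0.
have : [set: A] #<= [set: U].
  by apply: card_le_trans AU; have /card_eqPle[] := card_setT A.
move=> /card_leTTP[f fI].
exists (fun x =>
  if pselect (A x) is left Ax then f (SigSub (mem_set Ax)) else u0).
move=> x y /set_mem Ax /set_mem Ay.
case: pselect => // Ax'; case: pselect => // Ay' /fI.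
by move/(congr1 val).
Qed.

(* Hönig's argument: a maximal set of choice functions on which every
   evaluation is injective must have a surjective evaluation. *)
Lemma ex_min_card (I : Type) (i0 : I) (A : I -> Type) :
  exists j, forall i, exists f : A j -> A i, injective f.
Proof.
pose P := [set S : set (forall i, A i) |
  forall i x y, S x -> S y -> x i = y i -> x = y].
have [F FP Ftot|S [SP Smax]] := @Zorn_bigcup _ P.
  move=> i x y [X FX Xx] [Y FY Yy].
  have [XY|YX] := Ftot _ _ FX FY; first by apply: (FP _ FY) => //; exact: XY.
  by apply: (FP _ FX) => //; exact: YX.
have [j Sj] : exists j, forall a : A j, exists2 x, S x & x j = a.
  apply: contrapT => /forallNP/= H.
  have Ha i : {a : A i | forall x, S x -> x i <> a}.
    have /existsNP/cid[a na] := H i.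
    by exists a => x Sx xa; apply: na; exists x.
  pose z i := sval (Ha i).
  have Sz x : S x -> forall i, x i <> z i by move=> Sx i; exact: (svalP (Ha i)).
  (* In every coordinate [z] differs from all members of [S], so evaluations stay injective; the
     index [i0] shows that [z] is new. *)
  apply: (Smax (S `|` [set z])).
    split; first by move=> x; left.
    by move=> /(_ z (or_intror erefl)) /Sz /(_ i0).
  move=> i x y [Sx|->] [Sy|->] //; first exact: SP.
    by move/(Sz _ Sx).
  by move/esym/(Sz _ Sy).
exists j => i.
pose g (a : A j) := s2val (cid2 (Sj a)).
have Sg a : S (g a) by exact: (s2valP (cid2 (Sj a))).
have gj a : g a j = a by exact: (s2valP' (cid2 (Sj a))).
exists (fun a => g a i) => a b /(SP _ _ _ (Sg a) (Sg b)) gab.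
by rewrite -(gj a) gab gj.
Qed.

Lemma card_le_total (T U : Type) :
  [set: T] #<= [set: U] \/ [set: U] #<= [set: T].
Proof.
have [[] H] := ex_min_card true (fun b : bool => if b then T else U).
  by left; apply/card_leTTP; exact: (H false).
by right; apply/card_leTTP; exact: (H true).
Qed.

Lemma card_lt_set (T : Type) : card_lt T (set T).
Proof.
split; first by apply/card_leTTP; exists set1 => x y /seteqP[/(_ x erefl)].
move=> /card_leTTP[f fI].
(* Cantor's diagonal run through codes: the codes of subsets that do not contain their own code. *)
pose D := [set x | exists2 S, f S = x & ~ S x].
have [Df|nDf] := pselect (D (f D)); last by apply: (nDf); exists D.
have [S /fI SD nS] := Df.
by apply: nS; rewrite SD.
Qed.

(** Among the subsets of [set L] that do not inject into [L], take one of least cardinality. A type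
    above [L] either dominates [set L] or embeds in it as such a subset. *)
Lemma ex_succ_card (L : Type) : exists K, is_succ_card K L.
Proof.
pose J := sig (fun A : set (set L) => ~ (A #<= [set: L])).
have [j Hj] := @ex_min_card J (exist _ setT (card_lt_set L).2)
  (fun A => set_type (sval A)).
have cT (A : set (set L)) : ([set: A] #<= A) /\ (A #<= [set: A]).
  by apply/card_eqPle; exact: card_setT.
have nj : ~ ([set: sval j] #<= [set: L]).
  by move=> H; apply: (svalP j); apply: card_le_trans H; exact: (cT _).2.
exists (set_type (sval j)); split.
  by split=> //; have [//|] := card_le_total (set_type (sval j)) L.
move=> C [LC nCL]; have [H|/card_leTTP[f fI]] := card_le_total (set L) C.
  apply: card_le_trans H; apply/card_leTTP; exists val; exact: val_inj.
have fC : range f #= [set: C] by apply: inj_card_eq => x y _ _; exact: fI.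
have nfL : ~ (range f #<= [set: L]).
  by move=> H; apply: nCL; apply: card_le_trans H; have /card_eqPle[] := fC.
have /card_leTTP H :=
  Hj (exist (fun A : set (set L) => ~ (A #<= [set: L])) _ nfL).
apply: card_le_trans H _ => /=; apply: card_le_trans (cT _).1 _.
by have /card_eqPle[] := fC.
Qed.

(** * Well orders and transfinite choice *)

Lemma well_order_wf (T : eqType) (R : rel T) : wochoice.well_order R ->
  well_founded (fun x y => R x y /\ x <> y) /\
  (forall x y, x <> y -> (R x y /\ x <> y) \/ (R y x /\ y <> x)).
Proof.
move=> woR.
have antiR : antisymmetric R.
  move=> x y xy; have := @wochoice.wo_chain_antisymmetric T R predT.
  by apply => //; apply: wochoice.withinW.
have totR : total R.
  move=> x y; apply: (@wochoice.wo_chainW T R predT) => //.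
  exact: wochoice.withinW.
split; last first.
  move=> x y xy; have /orP[Rxy|Ryx] := totR x y; first by left.
  by right; split => // /esym.
move=> x; apply: contrapT => nx.
have [|z [[/asboolP nz zmin] _]] :=
    woR (fun x => `[< ~ Acc (fun x y => R x y /\ x <> y) x >]).
  by exists x; apply/asboolP.
apply: nz; split => y [Ryz yz]; apply: contrapT => ny.
apply: yz; apply: antiR; rewrite Ryz /=; apply: zmin; exact/asboolP.
Qed.

(** A substitute for an initial ordinal: if some segment of a well order is as large as [T], the
    order is pulled back along an injection of [T] into the segment below the least such point. *)
Lemma ex_small_segments (T : Type) : exists S : T -> T -> Prop,
  [/\ well_founded S, forall x y, x <> y -> S x y \/ S y x
    & forall x, ~ ([set: T] #<= [set y | S y x])].
Proof.
elim/Peq: T => T.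
have [R /well_order_wf] := wochoice.well_ordering_principle T.
pose S x y := R x y /\ x <> y.
move=> [Swf Stot]; have {}Swf : well_founded S by [].
have [[w0 Hw0]|H] := pselect (exists w, [set: T] #<= [set y | S y w]);
  last first.
  by exists S; split => // x Hx; apply: H; exists x.
have [w Tw wmin] : exists2 w, [set: T] #<= [set y | S y w] &
    forall v, S v w -> ~ ([set: T] #<= [set y | S y v]).
  elim/(well_founded_ind Swf): w0 Hw0 => w IH Hw.
  have [[v [vw Hv]]|H] :=
    pselect (exists v, S v w /\ [set: T] #<= [set y | S y v]).
    exact: IH vw Hv.
  by exists w => // v vw Hv; apply: H; exists v.
have [j jI jw] : exists2 j : T -> T, injective j & forall x, S (j x) w.
  have : [set: T] #<= [set: [set y | S y w]].
    apply: card_le_trans Tw _.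
    by have /card_eqPle[] := card_setT [set y | S y w].
  move=> /card_leTTP[f fI]; exists (fun x => val (f x)).
    by move=> x y /val_inj/fI.
  by move=> x; exact: set_mem (valP (f x)).
exists (fun x y => S (j x) (j y)); split.
- move=> x; move: {2}(j x) (erefl (j x)) => v.
  elim/(well_founded_ind Swf): v x => v IH x xv; split => y.
  by rewrite xv => /IH; apply.
- by move=> x y xy; apply: Stot => /jI.
move=> x Hx; apply: (wmin (j x)) => //; apply: card_le_trans Hx _.
have <- : (j @` [set y | S (j y) (j x)] #<= [set y | S y (j x)]) =
          ([set y | S (j y) (j x)] #<= [set y | S y (j x)]).
  by apply: card_le_eql; apply: inj_card_eq => a b _ _; exact: jI.
by apply: subset_card_le => _ [y Sy <-].
Qed.

(** Transfinite recursion: at stage [t] fewer points than [T] has elements are used up, so [P t]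
    still offers a new one. *)
Lemma ex_injective_choice (T X : Type) (P : T -> set X) :
  (forall t, [set: T] #<= P t) ->
  exists x : T -> X, injective x /\ forall t, P t (x t).
Proof.
move=> TP; have [[t0]|nT] := pselect (inhabited T); last first.
  by exists (fun t => False_rect _ (nT (inhabits t))); split => t; case: nT.
have [x0 _] : P t0 !=set0.
  apply/set0P/eqP => P0; have := TP t0; rewrite P0.
  by move=> /card_le0P/seteqP[/(_ t0 Logic.I) []].
have [S [Swf Stot Ssm]] := ex_small_segments T.
pose pick (Q : set X) :=
  if pselect (Q !=set0) is left Q0 then sval (cid Q0) else x0.
have pickP Q : Q !=set0 -> Q (pick Q).
  by move=> Q0; rewrite /pick; case: pselect => // {}Q0; exact: svalP.
pose F t (x : forall u, S u t -> X) : X :=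
  pick [set y | P t y /\ forall u (h : S u t), x u h <> y].
pose x := Fix Swf (fun=> X) F.
have xE t : x t = pick [set y | P t y /\ forall u, S u t -> x u <> y].
  rewrite {1}/x Fix_eq// => {}t f g fg; congr F.
  apply: functional_extensionality_dep => u.
  exact: functional_extensionality_dep.
have xP t : P t (x t) /\ forall u, S u t -> x u <> x t.
  rewrite xE; apply: (pickP [set y | P t y /\ forall u, S u t -> x u <> y]).
  apply: contrapT => /forallNP H; apply: (Ssm t).
  apply: card_le_trans (TP t) _.
  apply: (@card_le_trans _ _ _ (x @` [set u | S u t]));
    last exact: card_image_le.
  apply: subset_card_le => y Py; apply: contrapT => ny; apply: (H y).
  by split => // u Su xuy; apply: ny; exists u.
exists x; split; last by move=> t; exact: (xP t).1.
move=> t u xtu; apply: contrapT => /Stot[|] /((xP _).2); exact.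
Qed.

(** * Closed sets in separable spaces *)

(** Known as a countable network: the [B i] are arbitrary sets. *)
Definition countably_based (T : topologicalType) :=
  exists (I : countType) (B : I -> set T),
    forall x U, nbhs x U -> exists2 i, B i x & B i `<=` U.

Lemma countably_based_real (R : realType) : countably_based R.
Proof.
exists (rat * rat)%type, (fun i => `]ratr i.1, ratr i.2[%classic : set R).
move=> x U /nbhs_ballP[e /= e0 xeU].
have /rat_in_itvoo[p] : x - e < x by rewrite ltrBlDr ltrDl.
have /rat_in_itvoo[q] : x < x + e by rewrite ltrDl.
rewrite !in_itv/= => /andP[xq qe] /andP[ep px].
exists (p, q) => /=; first by rewrite in_itv/= px xq.
move=> y /=; rewrite in_itv/= => /andP[py yq]; apply: xeU.
rewrite /ball/= ltr_distlC; apply/andP; split.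
  exact: lt_trans ep py.
exact: lt_trans yq qe.
Qed.

Lemma countably_based_rV (T : topologicalType) n :
  countably_based T -> countably_based 'rV[T]_n.
Proof.
move=> [I [B BP]].
exists 'rV[I]_n, (fun i : 'rV[I]_n =>
  [set x : 'rV[T]_n | forall j, B (i ord0 j) (x ord0 j)]).
move=> x U [P xP PU].
have H j : {i | B i (x ord0 j) & B i `<=` P ord0 j}.
  by apply: cid2; exact: BP.
exists (\row_j s2val (H j)) => [j|y yB].
  by rewrite mxE; exact: (s2valP (H j)).
apply: PU => i j; rewrite (ord1 i); apply: (s2valP' (H j)).
by have := yB j; rewrite mxE.
Qed.

Lemma countably_based_prod (T U : topologicalType) :
  countably_based T -> countably_based U -> countably_based (T * U)%type.
Proof.
move=> [I [B BP]] [J [C CP]].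
exists (I * J)%type, (fun ij => B ij.1 `*` C ij.2).
move=> [x y] W [[P Q] /= [xP yQ] PQW].
have [i ix iP] := BP _ _ xP; have [j jy jQ] := CP _ _ yQ.
exists (i, j) => // -[x' y'] [/= x'B y'C].
by apply: PQW; split; [exact: iP|exact: jQ].
Qed.

Lemma card_set_count_le (I : countType) : [set: set I] #<= [set: set nat].
Proof.
apply/card_leTTP; exists (fun A => pickle @` A) => A B AB.
apply/seteqP; split => i Ai.
  have : (pickle @` B) (pickle i) by rewrite -AB; exists i.
  by move=> [j Bj /(pcan_inj pickleK) <-].
have : (pickle @` A) (pickle i) by rewrite AB; exists i.
by move=> [j Bj /(pcan_inj pickleK) <-].
Qed.

(* A closed set is determined by the basic sets that it misses. *)
Lemma card_closed_le (T : topologicalType) : countably_based T ->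
  [set F : set T | closed F] #<= [set: set nat].
Proof.
move=> [I [B BP]]; apply: card_le_trans (card_set_count_le I).
pose f (F : set T) := [set i | B i `&` F = set0].
suff fI : {in [set F : set T | closed F] &, injective f}.
  have /card_eqPle[_ H] := inj_card_eq fI.
  by apply: card_le_trans H _; exact: card_leT.
have H F G : closed F -> f F = f G -> G `<=` F.
  move=> cF FG x Gx; apply: contrapT => nFx.
  have /BP[i ix iF] : nbhs x (~` F).
    by apply: open_nbhs_nbhs; split; [exact: closed_openC|].
  have : f F i by apply/disjoints_subset.
  by rewrite FG => /seteqP[/(_ x) + _]; apply.
move=> F G /set_mem cF /set_mem cG FG; apply/seteqP; split; [|exact: H].
by apply: H.
Qed.

Lemma card_le_set_nat (T : topologicalType) : hausdorff_space T ->
  countably_based T -> [set: T] #<= [set: set nat].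
Proof.
move=> hT /card_closed_le; apply: card_le_trans.
have <- : (range (@set1 T) #<= [set F : set T | closed F]) =
    ([set: T] #<= [set F : set T | closed F]).
  by apply: card_le_eql; apply: inj_card_eq => x y _ _ /seteqP[/(_ x erefl)].
apply: subset_card_le => _ [x _ <-].
exact/accessible_closed_set1/hausdorff_accessible.
Qed.

Lemma dist_continuous (R : realType) (V : normedModType R) (r : V) :
  continuous (fun x : V => `|x - r|).
Proof.
by move=> x; apply: cvg_norm; apply: cvgB; [exact: cvg_id|exact: cvg_cst].
Qed.

Lemma closed_dist_le (R : realType) (V : normedModType R) (r : V) (d : R) :
  closed [set x : V | `|x - r| <= d].
Proof.
apply: (@preimage_closed _ _ (fun x => `|x - r|) [set x : R | x <= d]).
  by move=> x _; exact: dist_continuous.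
exact: closed_le.
Qed.

(** * The Cantor scheme in an uncountable compact set *)

Section CantorScheme.
Variables (R : realType) (V : normedModType R) (P : set V).
Hypotheses (Vb : countably_based V) (cP : compact P).

Let big (A : set V) := closed A /\ ~ countable (A `&` P).

(* Two distinct condensation points of [A `&` P] have disjoint closed
   neighbourhoods. *)
Let big_split A : big A -> exists A01 : set V * set V,
  [/\ big A01.1, big A01.2, A01.1 `<=` A, A01.2 `<=` A
    & A01.1 `&` A01.2 = set0].
Proof.
move: Vb => [I [B BP]] [cA uA].
(* The common points of [A] and [P] outside the countable set [N] are condensation points. *)
pose N := \bigcup_(i in [set i | countable (B i `&` (A `&` P))])
  (B i `&` (A `&` P)).
have cN : countable N by apply: bigcup_countable => //; exact: countableP.
have uD : ~ countable ((A `&` P) `\` N).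
  move=> cD; apply: uA; apply: (@sub_countable _ _ _ (((A `&` P) `\` N) `|` N)).
    apply: subset_card_le => x APx.
    by have [|nN] := pselect (N x); [right|left].
  rewrite setUC -bigcup2E; apply: bigcup_countable => // i _.
  by case: i => [|[|i]].
have [p Dp] : ((A `&` P) `\` N) !=set0.
  by apply/set0P/eqP => D0; apply: uD; rewrite D0.
have [q [Dq pq]] : exists q, ((A `&` P) `\` N) q /\ q <> p.
  apply: contrapT => /forallNP H; apply: uD.
  apply: (@sub_countable _ _ _ [set p]) => //; apply: subset_card_le => q Dq.
  by apply: contrapT => qp; apply: (H q).
(* With a third, a common point of the two balls would give 3d <= 2d. *)
pose d := `|q - p| / 3.
have d0 : 0 < d by rewrite divr_gt0// normr_gt0 subr_eq0; exact/eqP.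
have bigd r : ((A `&` P) `\` N) r -> big (A `&` [set x | `|x - r| <= d]).
  move=> [APr nNr]; split.
    by apply: closedI => //; exact: closed_dist_le.
  move=> cr; apply: nNr.
  have /BP[i ir iU] : nbhs r [set x | `|x - r| <= d].
    apply/nbhs_ballP; exists d => //= x; rewrite -ball_normE/= distrC.
    exact: ltW.
  exists i; last by split.
  apply: sub_countable cr; apply: subset_card_le => x [/iU ? [? ?]].
  by split.
exists (A `&` [set x | `|x - p| <= d], A `&` [set x | `|x - q| <= d]).
split=> /=.
- exact: bigd.
- exact: bigd.
- by move=> x [].
- by move=> x [].
apply/seteqP; split => // x [[_ /= xp] [_ /= xq]].
have : `|q - p| <= d + d.
  rewrite -(subrKA x) addrC; apply: (le_trans (ler_normD _ _)).
  by apply: lerD => //; rewrite distrC.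
have -> : `|q - p| = d *+ 3 by rewrite /d -mulr_natr divfK.
by rewrite 2!mulrS mulr1n leNgt ltrDr d0.
Qed.

(** The bits of [X] select a decreasing sequence of closed sets by repeated splitting; compactness
    puts a point of [P] in all of them. *)
Lemma compact_uncountable_card : ~ countable P -> [set: set nat] #<= P.
Proof.
move=> uP.
have /choice[g gP] : forall A, exists A01 : set V * set V, big A ->
    [/\ big A01.1, big A01.2, A01.1 `<=` A, A01.2 `<=` A
      & A01.1 `&` A01.2 = set0].
  move=> A; have [/big_split[A01 H]|nA] := pselect (big A); first by exists A01.
  by exists (A, A).
pose fix D (X : set nat) k := if k is k'.+1 then
  (if `[< X k' >] then (g (D X k')).1 else (g (D X k')).2) else setT.
have Dbig X k : big (D X k).
  elim: k => [|k IH] /=; first by split; [exact: closedT|rewrite setTI].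
  by have [] := gP _ IH; case: ifP.
have Dsub X k : D X k.+1 `<=` D X k.
  by have [_ _ ? ? _] := gP _ (Dbig X k) => /=; case: ifP.
have Dmono X j k : (j <= k)%N -> D X k `<=` D X j.
  move=> /subnK <-; elim: (k - j)%N => // i IH.
  exact: subset_trans (Dsub _ _) IH.
have Dne X k : exists x, (D X k `&` P) x.
  apply/set0P/eqP => D0; apply: (Dbig X k).2; rewrite D0; exact: countable0.
have /choice[x xP] : forall X, exists x, P x /\ forall k, D X k x.
  move=> X; have /choice[u uD] := Dne X.
  have [|p [Pp clp]] := cP (F := u @ \oo).
    by exists 0%N => // k _ /=; exact: (uD k).2.
  exists p; split => // k; have /closure_id -> := (Dbig X k).1.
  move=> U nU; apply: clp => //; exists k => // j /= kj.
  by apply: Dmono kj _ _; exact: (uD j).1.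
have xI : injective x.
  move=> X Y xXY; apply/seteqP.
  (* Two branches agree up to their first different bit, where a common point would lie in both
     halves of a disjoint splitting. *)
  have H : forall k, D X k = D Y k /\ (X k <-> Y k).
    elim/ltn_ind => k IH.
    have DE : D X k = D Y k.
      case: k IH => // k IH /=; have [-> XY] := IH k (ltnSn k).
      by rewrite (asbool_equiv_eq XY).
    split => //.
    have [_ _ _ _ dis] := gP _ (Dbig X k).
    have := (xP X).2 k.+1; have := (xP Y).2 k.+1; rewrite /= -DE -xXY.
    case: asboolP => Yk; case: asboolP => Xk // h1 h2; exfalso.
      by have : (set0 : set V) (x X) by rewrite -dis.
    by have : (set0 : set V) (x X) by rewrite -dis.
  by split => k /(H k).2.
have <- : (range x #<= P) = ([set: set nat] #<= P).
  by apply: card_le_eql; apply: inj_card_eq => a b _ _; exact: xI.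
by apply: subset_card_le => _ [X _ <-]; exact: (xP X).1.
Qed.

End CantorScheme.

(** An interval of positive length has positive Lebesgue measure, while countable sets are null. *)
Lemma uncountable_range (R : realType) (T : Type) (A : set T) (r : R)
    (phi : R -> T) :
  0 < r -> (forall s, 0 < s < r -> A (phi s)) ->
  {in `]0, r[%classic &, injective phi} -> ~ countable A.
Proof.
move=> r0 phiA phiI cA.
have : countable (`]0, r[%classic : set R).
  rewrite -(eq_countable (inj_card_eq phiI)); apply: sub_countable cA.
  apply: subset_card_le => _ [s sr <-]; apply: phiA.
  by move: sr; rewrite /= in_itv.
move/countable_lebesgue_measure0.
rewrite lebesgue_measure_itv/= lte_fin r0 oppr0 adde0.
by move=> /eqP; rewrite eqe gt_eqF.
Qed.

Lemma card_set_nat_real (R : realType) : [set: set nat] #<= [set: R].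
Proof.
apply: (@card_le_trans _ _ _ (`[0, 1]%classic : set R)); last exact: card_leT.
apply: compact_uncountable_card;
  [exact: countably_based_real|exact: segment_compact|].
apply: (@uncountable_range R R _ 1 id) => // s /andP[/ltW s0 /ltW s1].
by rewrite /= in_itv/= s0.
Qed.

Section Projections.
Variables (R : realType) (n : nat).
Implicit Types F : set ('rV[R]_n * R).

Lemma countably_based_rVR : countably_based ('rV[R]_n * R)%type.
Proof.
apply: countably_based_prod; last exact: countably_based_real.
exact/countably_based_rV/countably_based_real.
Qed.

Lemma compact_slab F (M : R) : closed F ->
  compact (F `&` [set p | `|p.1| <= M /\ `|p.2| <= M]).
Proof.
move=> cF.
have cK : compact ([set x : 'rV[R]_n | `|x| <= M] `*` [set t : R | `|t| <= M]).
  apply: compact_setX.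
    apply: bounded_closed_compact.
      exists M; split; first exact: num_real.
      by move=> N MN x /= xM; apply: le_trans xM _; exact: ltW.
    have := @closed_dist_le R 'rV[R]_n 0 M.
    by under eq_fun do rewrite subr0.
  rewrite (_ : [set t : R | _] = `[- M, M]%classic).
    exact: segment_compact.
  by apply/seteqP; split => t /=; rewrite in_itv/= ler_norml.
by rewrite setIC; exact: compact_closedI.
Qed.

(** [F] is a countable union of compact slabs; one of them has an uncountable, compact
    projection. *)
Lemma uncountable_proj_card F : closed F -> ~ countable (fst @` F) ->
  [set: set nat] #<= fst @` F.
Proof.
move=> cF uF.
pose G (m : nat) := F `&` [set p | `|p.1| <= m%:R /\ `|p.2| <= m%:R].
have [m um] : exists m, ~ countable (fst @` G m).
  apply: contrapT => /forallNP H; apply: uF.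
  apply: (@sub_countable _ _ _ (\bigcup_m (fst @` G m))); last first.
    by apply: bigcup_countable => // m _; apply: contrapT; exact: H.
  apply: subset_card_le => _ [[x t] Fxt <-].
  pose N := (Num.trunc (Num.max `|x| `|t|)).+1.
  have lN : Num.max `|x| `|t| <= N%:R.
    by rewrite ltW// truncnS_gt.
  exists N => //; exists (x, t) => //; split => //=; split.
    by apply: le_trans lN; rewrite le_max lexx.
  by apply: le_trans lN; rewrite le_max lexx orbT.
apply: (@card_le_trans _ _ _ (fst @` G m)).
  apply: compact_uncountable_card => //.
    exact/countably_based_rV/countably_based_real.
  apply: continuous_compact; last exact: compact_slab.
  by apply: continuous_subspaceT => p; exact: cvg_fst.
by apply: subset_card_le => _ [p [Fp _] <-]; exists p.
Qed.

End Projections.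

(** * A closed space of Jones functions *)

(** Each pair [(F, G)] is given its own point of the projection of [F], labelled [G], with [e]
    taking a value of [F] there. The pairs are no more numerous than the points of each projection,
    so no point has to serve two pairs. *)
Lemma ex_labelled_jones (R : realType) (n : nat) :
  exists (l : 'rV[R]_n -> set ('rV[R]_n * R)) (e : 'rV[R]_n -> R),
    (forall x, closed (l x)) /\
    forall F G : set ('rV[R]_n * R), closed F -> closed G ->
      ~ countable (fst @` F) -> exists x, l x = G /\ F (x, e x).
Proof.
pose X := ('rV[R]_n * R)%type.
have [c cI] := card_le_setP (card_closed_le (@countably_based_rVR R n)) set0.
pose Q (FG : set X * set X) :=
  [/\ closed FG.1, closed FG.2 & ~ countable (fst @` FG.1)].
have TP (t : sig Q) : [set: sig Q] #<= fst @` (sval t).1.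
  apply: (@card_le_trans _ _ _ [set: set nat]); last first.
    by apply: uncountable_proj_card; have [] := svalP t.
  apply: card_le_trans (card_set_count_le (bool * nat)%type).
  apply/card_leTTP; exists (fun t : sig Q => [set p : bool * nat |
    if p.1 then c (sval t).1 p.2 else c (sval t).2 p.2]).
  move=> [[F G] QF] [[F' G'] QF'] /= ceq; apply: eq_exist => /=.
  have [cF cG _] := QF; have [cF' cG' _] := QF'.
  have -> : F = F'.
    apply: cI; [exact/mem_set|exact/mem_set|].
    apply/seteqP; split=> k ck; have /= H := congr1 (@^~ (true, k)) ceq.
      by rewrite -H.
    by rewrite H.
  congr pair.
  apply: cI; [exact/mem_set|exact/mem_set|].
  apply/seteqP; split=> k ck; have /= H := congr1 (@^~ (false, k)) ceq.
    by rewrite -H.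
  by rewrite H.
have [x [xI xP]] := ex_injective_choice TP.
have /choice[le leP] : forall y, exists le : set X * R, closed le.1 /\
    forall t, x t = y -> le.1 = (sval t).2 /\ (sval t).1 (y, le.2).
  move=> y; have [[t xt]|nt] := pselect (exists t, x t = y); last first.
    (* Points serving no pair get a default label, which is closed. *)
    exists (set0, 0); split; first exact: closed0.
    by move=> t xt; case: nt; exists t.
  have [[y' s] Fs /= y'E] := xP t.
  exists ((sval t).2, s); split; first by have [] := svalP t.
  by move=> u; rewrite -xt => /xI ->; rewrite -y'E.
exists (fun y => (le y).1), (fun y => (le y).2); split=> [y|F G cF cG uF].
  exact: (leP y).1.
have QFG : Q (F, G) by [].
exists (x (exist Q (F, G) QFG)).
by have [] := (leP (x (exist Q (F, G) QFG))).2 _ erefl.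
Qed.

Section Independence.
Variables (R : realType) (E : lmodType R).
Implicit Types B L V : set E.

Lemma sub_lin_span B : B `<=` lin_span B.
Proof.
move=> v Bv; exists [:: v], (fun=> 1); split; last by rewrite big_seq1 scale1r.
by move=> w; rewrite inE => /eqP ->; exact/mem_set.
Qed.

Lemma lin_span_sub B V : GRing.submod_closed [pred v | v \in V] -> B `<=` V ->
  lin_span B `<=` V.
Proof.
move=> [V0 VD] BV _ [s [c [sB ->]]].
elim: s sB => [_|w s IH sB]; first by rewrite big_nil; exact: (set_mem V0).
rewrite big_cons; apply/set_mem; apply: VD.
  by apply/mem_set/BV/set_mem/sB; rewrite mem_head.
by apply/mem_set/IH => u us; apply: sB; rewrite inE us orbT.
Qed.

Lemma lin_indep_adjoin B v : lin_indep B -> ~ lin_span B v ->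
  lin_indep (B `|` [set v]).
Proof.
move=> Bi nv s c us sB s0.
have sB' w : w \in s -> w != v -> w \in B.
  move=> /sB /set_mem [Bw _|-> /eqP //]; exact/mem_set.
have [vs|vs] := boolP (v \in s); last first.
  apply: Bi => // w ws; apply: sB' => //; apply/eqP => wv.
  by move: vs; rewrite -wv ws.
have remB : {subset rem v s <= B}.
  by move=> w; rewrite (mem_rem_uniq v us) => /andP[/= wv ws]; exact: sB'.
rewrite (big_rem v vs)/= in s0.
have cv : c v = 0.
  apply: contrapT => /eqP cv; apply: nv.
  exists (rem v s), (fun w => - (c v)^-1 * c w); split => //.
  under eq_bigr do rewrite -scalerA.
  rewrite -scaler_sumr; apply: (scalerI cv).
  rewrite scalerA mulrN divff// scaleN1r.
  by apply: oppr_inj; rewrite opprK; exact: addr0_eq.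
rewrite cv scale0r add0r in s0.
move=> w ws; have [->//|wv] := eqVneq w v.
apply: (Bi (rem v s) c) => //; first exact: rem_uniq.
by rewrite (mem_rem_uniq v us) !inE wv.
Qed.

(** Zorn's lemma runs over the part added to [L], so that the empty chain is bounded by [set0]. *)
Lemma ex_hamel_basis L V : GRing.submod_closed [pred v | v \in V] ->
  lin_indep L -> L `<=` V -> exists2 B, L `<=` B & hamel_basis B V.
Proof.
move=> Vsub Li LV.
pose P := [set S : set E | lin_indep (L `|` S) /\ S `<=` V].
have [F FP Ftot|S [[Si SV] Smax]] := @Zorn_bigcup _ P.
  split; last by move=> v [S FS Sv]; have [_] := FP _ FS; exact.
  move=> s c us sB.
  have [S [SP sS]] : exists S, P S /\ {subset s <= L `|` S}.
    have [[S0 FS0]|nF] := pselect (F !=set0); last first.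
      exists set0; split; first by rewrite /P/= setU0; split.
      move=> v /sB /set_mem [Lv|[S FS _]]; first by apply/mem_set; left.
      by case: nF; exists S.
    suff [S FS sS] : exists2 S, F S & {subset s <= L `|` S}.
      by exists S; split => //; exact: FP.
    elim: s sB {us} => [_|v s IH sB]; first by exists S0.
    have [|S FS sS] := IH; first by move=> w ws; apply: sB; rewrite inE ws orbT.
    have /sB /set_mem [Lv|[S' FS' S'v]] : v \in v :: s by rewrite mem_head.
      exists S => // w; rewrite inE => /orP[/eqP ->|/sS //].
      by apply/mem_set; left.
    have [SS'|S'S] := Ftot _ _ FS FS'.
      exists S' => // w; rewrite inE => /orP[/eqP ->|/sS /set_mem [Lw|Sw]];
        apply/mem_set.
      - by right.
      - by left.
      - by right; exact: SS'.
    exists S => // w; rewrite inE => /orP[/eqP ->|/sS //].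
    by apply/mem_set; right; exact: S'S.
  exact: SP.1.
exists (L `|` S); first by move=> v; left.
have LSV : L `|` S `<=` V by move=> v [/LV|/SV].
split => //; apply/seteqP; split; first exact: lin_span_sub.
move=> v Vv; apply: contrapT => nv.
apply: (Smax (S `|` [set v])).
  split; first by move=> w; left.
  by move=> /(_ v (or_intror erefl)) Sv; apply: nv; apply: sub_lin_span; right.
split; first by rewrite setUA; exact: lin_indep_adjoin.
by move=> w [/SV|->].
Qed.

End Independence.

(** * The function space attached to a labelling, and its dimension *)

Section Spaceability.
Variables (R : realType) (n : nat).
Let X := ('rV[R]_n * R)%type.

(** A function is coded by its graph, and [X] injects into the reals. *)
Lemma card_real_fun_le : [set: 'rV[R]_n -> R] #<= [set: set R].
Proof.
have /card_leTTP[j jI] : [set: X] #<= [set: R].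
  apply: card_le_trans (card_set_nat_real R).
  apply: card_le_set_nat (@countably_based_rVR R n).
  exact: norm_hausdorff.
apply/card_leTTP; exists (fun f => [set j (x, f x) | x in setT]) => f g fg.
apply/funext => x.
have : [set j (x, g x) | x in setT] (j (x, f x)) by rewrite -fg; exists x.
by move=> [y _ /jI[-> ->]].
Qed.

Lemma card_dim_le (V : set ('rV[R]_n -> R)) (mu : Type) :
  has_dim V mu -> [set: mu] #<= [set: set R].
Proof.
move=> [B _ /card_eqPle[_ muB]]; apply: card_le_trans muB _.
by apply: card_le_trans card_real_fun_le; exact: card_leT.
Qed.

Lemma uncountable_rV : (0 < n)%N -> ~ countable [set: 'rV[R]_n].
Proof.
move=> n0; apply: (@uncountable_range R _ _ 1 const_mx) => // s t _ _.
by move=> /matrixP /(_ ord0 (Ordinal n0)); rewrite !mxE.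
Qed.

Variables (l : 'rV[R]_n -> set X) (e : 'rV[R]_n -> R).
Hypotheses (n0 : (0 < n)%N) (lc : forall x, closed (l x)).
Hypothesis le_hit : forall F G : set X, closed F -> closed G ->
  ~ countable (fst @` F) -> exists x, l x = G /\ F (x, e x).

(** At such a point a function [a (l x) * e x] shows its coefficient on the fiber of [G]. *)
Let graph_hit (G : set X) : closed G -> exists x, l x = G /\ e x = 1.
Proof.
move=> cG.
have [||x [lx ex]] := le_hit (F := [set p | p.2 = 1]) _ cG.
- apply: (@preimage_closed _ _ (fun p : X => p.2) [set 1]);
    last exact: closed_eq.
  by move=> p _; exact: cvg_snd.
- move=> H; apply: (uncountable_rV n0); apply: sub_countable H.
  by apply: subset_card_le => x _; exists (x, 1).
by exists x.
Qed.

(* The functions [x |-> a (l x) * e x] for arbitrary [a : set X -> R]. *)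
Definition fiber_space : set ('rV[R]_n -> R) :=
  [set g | forall x y, l x = l y -> g x * e y = g y * e x].

Lemma fiber_space_submod : GRing.submod_closed [pred g | g \in fiber_space].
Proof.
split=> [|a f g /set_mem Vf /set_mem Vg]; apply/mem_set => x y lxy.
  by rewrite !mul0r.
rewrite /= !fctE !mulrDl -!mulrA.
by rewrite (Vf _ _ lxy) (Vg _ _ lxy).
Qed.

(** Membership is a family of equations, each continuous in two evaluations. *)
Lemma fiber_space_closed : closed (fiber_space : set {ptws 'rV[R]_n -> R}).
Proof.
have ev (x : 'rV[R]_n) : continuous (fun g : {ptws 'rV[R]_n -> R} => g x).
  by move=> g; exact: (@proj_continuous 'rV[R]_n (fun=> R) x g).
have -> : fiber_space =
    \bigcap_(p in [set p : 'rV[R]_n * 'rV[R]_n | l p.1 = l p.2])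
    [set g : {ptws 'rV[R]_n -> R} | g p.1 * e p.2 - g p.2 * e p.1 = 0].
  apply/seteqP; split=> [g Vg [x y] /= lxy|g Vg x y lxy].
    by rewrite (Vg _ _ lxy) subrr.
  by apply/eqP; rewrite -subr_eq0; apply/eqP; exact: (Vg (x, y)).
apply: closed_bigI => -[x y] /= _.
apply: (@preimage_closed _ _
  (fun g : {ptws 'rV[R]_n -> R} => g x * e y - g y * e x) [set 0]).
  have evM u v : continuous (fun g : {ptws 'rV[R]_n -> R} => g u * e v).
    by move=> g; exact: (cvgM (ev u g) (cvg_cst (e v))).
  by move=> g _; exact: (cvgB (evM x y g) (evM y x g)).
exact: closed_eq.
Qed.

(** On some fiber [g] equals [a * e] with [a] nonzero; [e] on that fiber meets [F] rescaled
    vertically by the inverse of [a]. *)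
Lemma fiber_space_Jones : fiber_space `<=` Jones R n `|` [set 0].
Proof.
move=> g Vg; have [->|/eqP g0] := pselect (g = 0); first by right.
left=> F cF uF.
have [x0 gx0] : exists x, g x != 0.
  apply: contrapT => /forallNP H; move/eqP: g0; apply; apply/funext => x.
  by apply/eqP; apply: contrapT => /negP; exact: H.
have [y [ly ey]] := graph_hit (@lc x0).
pose a := g y.
have gE x : l x = l x0 -> g x = a * e x.
  by rewrite -ly => /Vg; rewrite ey mulr1.
have a0 : a != 0 by apply: contraNneq gx0 => a0; rewrite gE// a0 mul0r.
have [||x [lx Fx]] := le_hit (F := [set p | F (p.1, a * p.2)]) _ (@lc x0).
- apply: (@preimage_closed _ _ (fun p : X => (p.1, a * p.2)) F) => // p _.
  have c1 : (fun p : X => p.1) @ p --> p.1 by exact: cvg_fst.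
  have c2 : (fun p : X => a * p.2) @ p --> a * p.2.
    by apply: cvgM; [exact: cvg_cst|exact: cvg_snd].
  exact: (cvg_pair c1 c2).
- move=> H; apply: uF; apply: sub_countable H; apply: subset_card_le.
  move=> _ [[x t] Fxt <-]; exists (x, a^-1 * t) => //=.
  by rewrite mulVKf.
by exists x; rewrite gE.
Qed.

(** A label is read as a partial record of a subset: height 1 over a point means membership, any
    other height non-membership. [chi A] keeps [e] on the fibers whose record is correct for [A]. *)
Let chi (A : set 'rV[R]_n) (x : 'rV[R]_n) : R :=
  if `[< forall p, l x p -> (A p.1 <-> p.2 = 1) >] then e x else 0.

Let chi_fiber A : fiber_space (chi A).
Proof.
by move=> x y lxy; rewrite /chi lxy; case: asboolP => _; rewrite ?mul0r// mulrC.
Qed.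

(* A finite set of points of [X] recording how [A] differs from each member
   of [s] is closed, hence is a label. *)
Let chi_separate A (s : seq (set 'rV[R]_n)) : (forall B, B \in s -> B <> A) ->
  exists x, chi A x = 1 /\ forall B, B \in s -> chi B x = 0.
Proof.
move=> sA.
have /choice[p pP] : forall B, exists p, B <> A -> ~ (B p <-> A p).
  move=> B; have [->|BA] := pselect (B = A); first by exists 0.
  have [p Hp] : exists p, ~ (B p <-> A p).
    by apply/existsNP => H; apply: BA; apply/funext => p; exact/propext.
  by exists p.
pose pt B : X := (p B, if `[< A (p B) >] then 1 else 0).
have ptA B : A (p B) <-> (pt B).2 = 1.
  rewrite /pt/=; case: asboolP => Ap; first by [].
  by split=> // /esym/eqP; rewrite oner_eq0.
have [|x [lx ex]] := @graph_hit (pt @` [set` s]).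
  apply: (@accessible_finite_set_closed X).1;
    last exact/finite_image/finite_seq.
  by apply: hausdorff_accessible; exact: norm_hausdorff.
exists x; split=> [|B Bs]; rewrite /chi lx.
  by rewrite asboolT// => _ [B _ <-]; exact: ptA.
rewrite asboolF// => /(_ (pt B)) H; apply: (pP B); first exact: sA.
by rewrite ptA; apply: H; exists B.
Qed.

Let chi_inj : injective chi.
Proof.
move=> A B AB; apply: contrapT => nAB.
have [|x [Ax Bx]] := @chi_separate A [:: B].
  by move=> C; rewrite inE => /eqP -> /esym.
have := Bx B; rewrite mem_head -AB Ax => /(_ isT)/eqP.
by rewrite oner_eq0.
Qed.

(** A vanishing combination is evaluated where one chosen function is 1 and the others are 0. *)
Let chi_indep : lin_indep (range chi).
Proof.
move=> s c us sr s0 v vs.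
have /choice[h hP] : forall w, exists A, w \in s -> chi A = w.
  move=> w; have [/sr /set_mem [A _ Aw]|ws] := boolP (w \in s).
    by exists A.
  by exists set0.
have [|x [vx sx]] := @chi_separate (h v) [seq h w | w <- s & w != v].
  move=> B /mapP[w]; rewrite mem_filter => /andP[/eqP wv ws] -> hwv.
  by apply: wv; rewrite -(hP w ws) -(hP v vs) hwv.
have hx w : w \in s -> w x = (w == v)%:R.
  move=> ws; have [->|wv] := eqVneq w v; first by rewrite -{1}(hP v vs).
  rewrite -{1}(hP w ws) sx//; apply/mapP; exists w => //.
  by rewrite mem_filter wv.
have : \sum_(w <- s) c w * w x = 0.
  by have := congr1 (@^~ x) s0; rewrite fct_sumE.
rewrite (bigD1_seq v)//= hx// eqxx mulr1 big1_seq ?addr0//.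
by move=> w /andP[wv ws]; rewrite hx// (negbTE wv) mulr0.
Qed.

Lemma fiber_space_dim : has_dim fiber_space (set R).
Proof.
have [|B chiB BV] := ex_hamel_basis fiber_space_submod chi_indep.
  by move=> _ [A _ <-]; exact: chi_fiber.
exists B => //; apply/card_eqPle; split.
  by apply: card_le_trans card_real_fun_le; exact: card_leT.
have : range chi #<= B by exact: subset_card_le.
apply: card_le_trans.
rewrite -(card_le_eqr (card_esym (inj_card_eq (in2W chi_inj)))).
apply/card_leTTP; exists (fun A => @const_mx R 1 n @` A) => A A' AA'.
have cI : injective (@const_mx R 1 n).
  by move=> s t /matrixP /(_ ord0 (Ordinal n0)); rewrite !mxE.
apply/seteqP; split=> t At.
  have : (@const_mx R 1 n @` A') (const_mx t) by rewrite -AA'; exists t.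
  by move=> [u A'u /cI <-].
have : (@const_mx R 1 n @` A) (const_mx t) by rewrite AA'; exists t.
by move=> [u A'u /cI <-].
Qed.

End Spaceability.

Lemma Jones_spaceable (R : realType) (n : nat) : (0 < n)%N ->
  ptws_spaceable (Jones R n) (set R).
Proof.
move=> n0; have [l [e [lc hit]]] := ex_labelled_jones R n.
exists (fiber_space l e); split.
- exact: fiber_space_submod.
- exact: fiber_space_closed.
- exact: fiber_space_dim.
- exact: fiber_space_Jones.
Qed.

(** * Almost continuity *)

Section Patching.
Variables (R : realType) (n : nat) (F : set ('rV[R]_n * R)).
Hypothesis cF : closed F.

Definition avoids (g : 'rV[R]_n -> R) (x : 'rV[R]_n) := ~ F (x, g x).

(** For the maximum norm of row vectors, spheres are boundaries of cubes. *)
Definition free_sphere (x0 : 'rV[R]_n) (r : R) :=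
  forall p, F p -> `|p.1 - x0| <> r.

(** Truncation of [y] to the unit interval. *)
Let ramp (y : R) : R := (`|y| - `|y - 1| + 1) / 2.

Let ramp0 y : y <= 0 -> ramp y = 0.
Proof. by move=> y0; rewrite /ramp !ler0_norm; lra. Qed.

Let ramp1 y : 1 <= y -> ramp y = 1.
Proof. by move=> y1; rewrite /ramp !ger0_norm; lra. Qed.

Let ramp01 y : 0 <= ramp y <= 1.
Proof.
have [y0|y0] := leP y 0; first by rewrite ramp0// lexx ler01.
have [y1|y1] := leP 1 y; first by rewrite ramp1// lexx ler01.
rewrite /ramp gtr0_norm// ltr0_norm; last by lra.
by apply/andP; split; lra.
Qed.

Let ramp_continuous : continuous ramp.
Proof.
move=> y; apply: cvgM; last exact: cvg_cst.
apply: cvgD; last exact: cvg_cst.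
by apply: cvgB; [exact: norm_continuous|exact: (@dist_continuous R R 1)].
Qed.

(* Over a sphere that misses the projection of [F] every value is allowed, so
   by compactness the values between two bounded functions are allowed on a
   thin shell, where one interpolates. *)
Lemma patch_sphere (x0 : 'rV[R]_n) (r : R) (g1 g2 : 'rV[R]_n -> R) :
  0 < r -> free_sphere x0 r ->
  continuous g1 -> continuous g2 ->
  exists h, [/\ continuous h, forall x, `|x - x0| <= r -> h x = g1 x
    & forall x, r < `|x - x0| -> h x = g2 x \/ avoids h x].
Proof.
move=> r0 Sr cg1 cg2.
pose B := [set x : 'rV[R]_n | `|x - x0| <= r + 1].
have Bbd x : B x -> `|x| <= r + 1 + `|x0|.
  move=> Bx; rewrite -[x in `|x|](subrK x0); apply: le_trans (ler_normD _ _) _.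
  by rewrite lerD2r.
have cB : compact B.
  apply: bounded_closed_compact; last exact: closed_dist_le.
  exists (r + 1 + `|x0|); split; first exact: num_real.
  by move=> M ltM x /Bbd xM; apply: le_trans xM _; exact: ltW.
have bnd (g : 'rV[R]_n -> R) : continuous g ->
    exists M : R, forall x, B x -> `|g x| <= M.
  move=> cg; have cgB : compact (g @` B).
    by apply: continuous_compact => //; exact: continuous_subspaceT.
  have [M [_ HM]] := @compact_bounded R R^o _ cgB.
  exists (M + 1) => x Bx; apply: (HM (M + 1)); first by rewrite ltrDl.
  by exists x.
have [M1 gM1] := bnd _ cg1; have [M2 gM2] := bnd _ cg2.
pose M := Num.max (r + 1 + `|x0|) (Num.max M1 M2).
pose K := (F `&` [set p | `|p.1| <= M /\ `|p.2| <= M]).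
have cK : compact K by exact: compact_slab.
pose phi (p : 'rV[R]_n * R) := `|p.1 - x0| - r.
have cphi : continuous phi.
  move=> p; apply: cvgB; last exact: cvg_cst.
  have c1 : (fun q : 'rV[R]_n * R => q.1) @ p --> p.1 by exact: cvg_fst.
  exact: (cvg_comp _ _ c1 (@dist_continuous R _ x0 p.1)).
have cphiK : closed (phi @` K).
  apply: compact_closed; first exact: norm_hausdorff.
  by apply: continuous_compact => //; exact: continuous_subspaceT.
have /nbhs_ballP[d /= d0 dK] : nbhs (0 : R) (~` (phi @` K)).
  apply: open_nbhs_nbhs; split; first exact: closed_openC.
  move=> [p [Fp _] /eqP]; rewrite subr_eq0 => /eqP; exact: Sr.
(* The bound [d] keeps the shell clear of [K]; the bound 1 keeps it inside [B]. *)
pose e := Num.min d 1.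
have e0 : 0 < e by rewrite lt_min d0 ltr01.
have Ke p : K p -> r < `|p.1 - x0| -> r + e <= `|p.1 - x0|.
  move=> Kp rp; rewrite leNgt; apply/negP => pe.
  apply: (dK (phi p)); last by exists p.
  rewrite /ball/= sub0r normrN /phi gtr0_norm ?subr_gt0// ltrBlDl.
  by apply: lt_le_trans pe _; rewrite lerD2l ge_min lexx.
pose s (x : 'rV[R]_n) : R := ramp ((`|x - x0| - r) / e).
exists (fun x => g1 x + s x * (g2 x - g1 x)); split.
- have cs (x : 'rV[R]_n) : s @ x --> s x.
    have d1 : (fun y : 'rV[R]_n => `|y - x0|) @ x --> `|x - x0|.
      exact: dist_continuous.
    have c1 := cvgM (cvgB d1 (cvg_cst r)) (cvg_cst e^-1).
    have c2 : (fun y : 'rV[R]_n => (`|y - x0| - r) / e) @ x -->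
        (`|x - x0| - r) / e by exact: c1.
    exact: (cvg_comp _ _ c2 (@ramp_continuous ((`|x - x0| - r) / e))).
  by move=> x; exact: (cvgD (cg1 x) (cvgM (cs x) (cvgB (cg2 x) (cg1 x)))).
- move=> x xr; have -> : s x = 0.
    by apply: ramp0; rewrite ler_pdivrMr// mul0r subr_le0.
  by rewrite mul0r addr0.
move=> x rx; have [xe|xe] := leP (r + e) `|x - x0|.
  left; have -> : s x = 1 by apply: ramp1; rewrite ler_pdivlMr// mul1r lerBrDl.
  by rewrite mul1r subrKC.
right=> Fx; move: (xe); rewrite ltNge => /negP; apply.
apply: (Ke (x, g1 x + s x * (g2 x - g1 x))) => //.
have Bx : B x.
  by apply: le_trans (ltW xe) _; rewrite lerD2l ge_min lexx orbT.
split => //=; split.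
  by apply: le_trans (Bbd _ Bx) _; rewrite le_max lexx.
have /andP[s0 s1] : 0 <= s x <= 1 by exact: ramp01.
have s1' : 0 <= 1 - s x by rewrite subr_ge0.
(* A convex combination of values bounded by [M] is bounded by [M], so the point lies in [K]. *)
have -> : g1 x + s x * (g2 x - g1 x) = (1 - s x) * g1 x + s x * g2 x by ring.
apply: le_trans (ler_normD _ _) _; rewrite (normrM (1 - s x)) (normrM (s x)).
rewrite (ger0_norm s0) (ger0_norm s1').
have g1M : `|g1 x| <= M.
  by apply: le_trans (gM1 _ Bx) _; rewrite !le_max lexx orbT.
have g2M : `|g2 x| <= M.
  by apply: le_trans (gM2 _ Bx) _; rewrite !le_max lexx !orbT.
have -> : M = (1 - s x) * M + s x * M by ring.
by apply: lerD; apply: ler_wpM2l.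
Qed.

Hypothesis countF : countable (fst @` F).

(** Only countably many radii are distances from [x0] to the projection of [F]. *)
Lemma ex_free_sphere (x0 : 'rV[R]_n) (a b : R) : 0 <= a -> a < b ->
  exists r, a < r < b /\ free_sphere x0 r.
Proof.
move=> a0 ab; apply: contrapT => /forallNP H.
pose D := (fun x : 'rV[R]_n => `|x - x0|) @` (fst @` F).
have cD : countable D by apply: sub_countable countF; exact: card_image_le.
apply: (@uncountable_range R R D (b - a) (fun s => a + s)) cD.
- by rewrite subr_gt0.
- move=> s /andP[s0 sb]; apply: contrapT => nD; apply: (H (a + s)); split.
    by rewrite ltrDl s0 -ltrBrDl.
  by move=> p Fp pE; apply: nD; exists p.1 => //; exists p.
by move=> s t _ _ /addrI.
Qed.

Variable f : 'rV[R]_n -> R.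
Hypothesis fF : forall x, avoids f x.

Let local_ball (x0 : 'rV[R]_n) : exists r, [/\ 0 < r, free_sphere x0 r
  & forall x, `|x - x0| <= r -> ~ F (x, f x0)].
Proof.
have [[A B] /= [Ax Bf] AB] : nbhs (x0, f x0) (~` F).
  by apply: open_nbhs_nbhs; split; [exact: closed_openC|exact: fF].
have /nbhs_ballP[e /= e0 eA] := Ax.
have [r [/andP[r0 re] Sr]] := ex_free_sphere x0 (lexx 0) e0.
exists r; split=> // x xr; apply: (AB (x, f x0)).
split; last exact: nbhs_singleton.
apply: eA; rewrite -ball_normE/= distrC; exact: le_lt_trans xr re.
Qed.

(** A finite subcover is treated ball by ball: the constant [f y] inside the new ball is patched to
    the function built so far. *)
Lemma avoid_on_compact (K : set 'rV[R]_n) : compact K ->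
  exists2 g, continuous g & forall x, K x -> avoids g x.
Proof.
have /choice[r rP] := local_ball.
rewrite compact_cover => /(_ 'rV[R]_n setT (fun x => ball x (r x))).
move=> [|x Kx|D _ KD].
- by move=> x _; exact: ball_open.
- by exists x => //; apply: ballxx; have [] := rP x.
suff [g cg gP] : exists2 g, continuous g &
    forall x y, y \in finmap.enum_fset D -> `|x - y| <= r y -> avoids g x.
  exists g => // x /KD [y /= yD]; rewrite -ball_normE/= distrC => xy.
  exact: gP yD (ltW xy).
elim: (finmap.enum_fset D) => [|y s [g cg gP]].
  by exists (fun=> 0) => //; exact: cst_continuous.
have [r0 Sr yF] := rP y.
have [h [ch h1 h2]] := patch_sphere r0 Sr (@cst_continuous _ _ (f y)) cg.
have hy x : `|x - y| <= r y -> avoids h x.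
  by move=> xy; rewrite /avoids h1//; exact: yF.
exists h => // x z; rewrite inE => /orP[/eqP ->|zs xz]; first exact: hy.
have [xy|xy] := leP `|x - y| (r y); first exact: hy.
have [hg|//] := h2 _ xy; rewrite /avoids hg; exact: gP zs xz.
Qed.

(** Space is exhausted by balls with free boundary spheres. Each stage keeps the previous values on
    its ball, so the sequence is locally eventually constant. *)
Lemma avoid_everywhere : exists2 g, continuous g & forall x, avoids g x.
Proof.
have /choice[rho rhoP] : forall k : nat, exists r : R,
    k%:R < r < k.+1%:R /\ free_sphere 0 r.
  by move=> k; apply: ex_free_sphere; [exact: ler0n|rewrite ltr_nat].
have rho0 k : 0 < rho k by have [/andP[/(le_lt_trans _)->//]] := rhoP k.
have rho_mono j k : (j <= k)%N -> rho j <= rho k.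
  rewrite leq_eqVlt => /orP[/eqP -> //|jk].
  have [/andP[_ jS] _] := rhoP j; have [/andP[kS _] _] := rhoP k.
  apply/ltW/(lt_trans jS)/(le_lt_trans _ kS); by rewrite ler_nat.
have /choice[g gP] : forall k : nat, exists g, continuous g /\
    forall x, `|x| <= rho k -> avoids g x.
  move=> k; have [|g cg gP] := @avoid_on_compact [set x | `|x - 0| <= rho k].
    apply: bounded_closed_compact; last exact: closed_dist_le.
    exists (rho k); split; first exact: num_real.
    by move=> M ltM x /=; rewrite subr0 => xM; apply: le_trans xM _; exact: ltW.
  by exists g; split => // x xr; apply: gP; rewrite /= subr0.
have /choice[step stepP] : forall kh : nat * ('rV[R]_n -> R), exists h',
    continuous kh.2 -> [/\ continuous h',
      forall x, `|x| <= rho kh.1 -> h' x = kh.2 x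
    & forall x, rho kh.1 < `|x| -> h' x = g kh.1.+1 x \/ avoids h' x].
  move=> [k h] /=; have [ch|nch] := pselect (continuous h); last by exists h.
  have [h' [ch' h'1 h'2]] := patch_sphere (rho0 k) (rhoP k).2 ch (gP k.+1).1.
  exists h' => _; split => // x xr; [apply: h'1|apply: h'2]; by rewrite subr0.
pose fix h k := if k is k'.+1 then step (k', h k') else g 0%N.
have hc k : continuous (h k).
  elim: k => [|k IH] /=; first exact: (gP 0%N).1.
  by have [] := stepP (k, h k) IH.
have hS k x : `|x| <= rho k -> h k.+1 x = h k x.
  by have [_ + _] := stepP (k, h k) (hc k); exact.
have hav k x : `|x| <= rho k -> avoids (h k) x.
  elim: k x => [|k IH] x xr; first exact: (gP 0%N).2.
  have [xk|xk] := leP `|x| (rho k); first by rewrite /avoids hS//; exact: IH.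
  have [_ _ /(_ _ xk)[E|//]] := stepP (k, h k) (hc k).
  by rewrite /avoids /= E; exact: (gP k.+1).2.
have hmono j k x : (j <= k)%N -> `|x| <= rho j -> h k x = h j x.
  move=> jk xj; rewrite -(subnK jk); elim: (k - j)%N => // i IH.
  by rewrite addSn hS// (le_trans xj)// rho_mono// leq_addl.
(* The successor makes the norm of [x] smaller than [N x], hence than [rho (N x)]. *)
pose N (x : 'rV[R]_n) := (Num.trunc `|x|).+1.
have xN x : `|x| < rho (N x).
  have [/andP[+ _] _] := rhoP (N x); apply: lt_trans; exact: truncnS_gt.
pose G x := h (N x) x.
have GE k x : `|x| <= rho k -> G x = h k x.
  move=> xk; have [jk|kj] := leqP (N x) k; first by rewrite (hmono (N x))// ltW.
  by rewrite /G (hmono k)// ltnW.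
exists G => [x|x]; last by rewrite /avoids /G; apply: hav; exact: ltW.
have nG : \forall y \near x, h (N x) y = G y.
  have : nbhs x ((fun y : 'rV[R]_n => `|y|) @^-1` [set t | t < rho (N x)]).
    apply: (@norm_continuous _ 'rV[R]_n x [set t : R | t < rho (N x)]).
    apply: open_nbhs_nbhs; split; [exact: open_lt|exact: xN].
  by apply: filterS => y /= yN; rewrite (GE (N x))// ltW.
rewrite /continuous_at/= (GE (N x)) ?ltW//.
apply: cvg_trans (hc (N x) x).
exact: (@near_eq_cvg _ _ (nbhs x) _ _ _ nG).
Qed.

End Patching.

Lemma Jones_almost_continuous (R : realType) (n : nat) :
  Jones R n `<=` almost_continuous R n.
Proof.
move=> f Jf U oU fU.
have cF : closed (~` U) by exact: open_closedC.
have countF : countable (fst @` (~` U)).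
  by apply: contrapT => uF; have [x] := Jf _ cF uF; apply.
have [|g cg gU] := avoid_everywhere cF countF (f := f).
  by move=> x; apply.
by exists g => // x; apply: contrapT; exact: gU.
Qed.

(** * Failure of the Darboux property *)

Section NotDarboux.
Variables (R : realType) (n : nat).
Hypothesis n2 : (2 <= n)%N.
Let V := 'rV[R]_n.

(** In dimension at least 2, two coordinate vectors cannot both be multiples of [d]. *)
Lemma ex_not_parallel (d : V) : exists w : V, forall c : R, w <> c *: d.
Proof.
pose i0 : 'I_n := Ordinal (ltnW n2); pose i1 : 'I_n := Ordinal n2.
apply: contrapT => /forallNP H.
have /existsNP[c /contrapT/rowP cE] := H (delta_mx ord0 i0).
have /existsNP[c' /contrapT/rowP c'E] := H (delta_mx ord0 i1).
have := cE i0; have := c'E i0; have := c'E i1; rewrite !mxE/=.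
move=> c1 c0 c00.
have d0 : d ord0 i0 != 0.
  by apply/eqP => d0; move/eqP: c00; rewrite d0 mulr0 oner_eq0.
have c'0 : c' = 0.
  by move/esym/eqP: c0; rewrite mulf_eq0 (negbTE d0) orbF => /eqP.
by move/eqP: c1; rewrite c'0 mul0r oner_eq0.
Qed.

Lemma path_continuous (a d : V) : continuous (fun t : R => a + t *: d).
Proof.
move=> t; apply: cvgD; first exact: cvg_cst.
by apply: cvgZr_tmp.
Qed.

(* Parallel segments [a + s w, b + s w] are pairwise disjoint and join the two
   open sets, so each of them must leave their union. *)
Lemma countable_not_separating (G H : set V) : open G -> open H ->
  G `&` H = set0 -> G !=set0 -> H !=set0 -> ~ countable (~` (G `|` H)).
Proof.
move=> oG oH GH0 [a Ga] [b Hb].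
have [w wd] := ex_not_parallel (b - a).
have near_open (U : set V) c : open U -> U c ->
    exists2 r : R, 0 < r & forall s, 0 < s < r -> U (c + s *: w).
  move=> oU Uc.
  have : nbhs (0 : R) ((fun s : R => c + s *: w) @^-1` U).
    apply: (@path_continuous c w 0 U); apply: open_nbhs_nbhs; split => //.
    by rewrite scale0r addr0.
  move=> /nbhs_ballP[r /= r0 rU]; exists r => // s /andP[s0 sr]; apply: rU.
  by rewrite /ball/= sub0r normrN gtr0_norm.
have [r1 r10 Gr] := near_open _ _ oG Ga.
have [r2 r20 Hr] := near_open _ _ oH Hb.
pose r := Num.min r1 r2.
have r0 : 0 < r by rewrite lt_min r10.
have /choice[t tP] : forall s, exists t : R, 0 < s < r ->
    (~` (G `|` H)) (a + s *: w + t *: (b - a)).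
  move=> s; have [/andP[s0 sr]|ns] := boolP (0 < s < r); last by exists 0.
  apply: contrapT => /forallNP Hn.
  have in_GH t : (G `|` H) (a + s *: w + t *: (b - a)).
    by apply: contrapT => nGH; apply: (Hn t).
  pose gam t := a + s *: w + t *: (b - a).
  have cgam : continuous gam by exact: path_continuous.
  have sr1 : s < r1 by apply: lt_le_trans sr _; rewrite ge_min lexx.
  have sr2 : s < r2 by apply: lt_le_trans sr _; rewrite ge_min lexx orbT.
  have g0 : G (gam 0) by rewrite /gam scale0r addr0; apply: Gr; rewrite s0.
  have h1 : H (gam 1).
    rewrite /gam scale1r addrAC subrKC; by apply: Hr; rewrite s0.
  (* A segment inside the union would have a clopen nonempty trace on [G], hence lie in [G],
     although it ends in [H]. *)
  have E : `[(0 : R), 1]%classic `&` gam @^-1` G = `[0, 1]%classic.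
    apply: (@segment_connected R 0 1).
    - by exists 0; split => //=; rewrite in_itv/= lexx ler01.
    - exists (gam @^-1` G) => //; apply: open_comp => // x _; exact: cgam.
    - exists (gam @^-1` (~` H)).
        apply: (@preimage_closed _ _ gam (~` H)); last exact: open_closedC.
        by move=> x _; exact: cgam.
      apply/seteqP; split => x [x01 Gx]; split => //.
        by move=> Hx; have : (set0 : set V) (gam x) by rewrite -GH0.
      by have [//|/Gx] := in_GH x.
  have : (`[(0 : R), 1]%classic `&` gam @^-1` G) 1.
    by rewrite E /= in_itv/= lexx ler01.
  by move=> [_ G1]; have : (set0 : set V) (gam 1) by rewrite -GH0.
apply: (@uncountable_range R V (~` (G `|` H)) r
  (fun s => a + s *: w + t s *: (b - a))) => //.
(* If the chosen points on two segments coincided, [w] would be a multiple of [b - a]. *)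
move=> s s' _ _; rewrite -!addrA => /addrI E; apply: contrapT => /eqP ss'.
apply: (wd ((s - s')^-1 * (t s' - t s))).
have ss0 : s - s' != 0 by rewrite subr_eq0.
rewrite -scalerA; apply: (scalerI ss0); rewrite [RHS]scalerA divff// scale1r.
rewrite !scalerBl; apply/eqP; rewrite subr_eq addrAC eq_sym subr_eq eq_sym.
by rewrite [X in _ == X]addrC E.
Qed.

Lemma uncountable_closed_ball (c : V) (r : R) : 0 < r ->
  ~ countable [set x : V | `|x - c| <= r].
Proof.
move=> r0.
have [w w0] := ex_not_parallel 0.
have wn0 : w != 0 by apply/eqP => w0'; apply: (w0 0); rewrite scale0r.
have nw0 : 0 < `|w| by rewrite normr_gt0.
apply: (@uncountable_range R V _ (r / `|w|) (fun s => c + s *: w)).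
- by rewrite divr_gt0.
- move=> s /andP[s0 sr] /=; rewrite addrAC subrr add0r normrZ gtr0_norm//.
  by rewrite -ler_pdivlMr// ltW.
- move=> s s' _ _ /addrI/eqP; rewrite -subr_eq0 -scalerBl scaler_eq0.
  by rewrite (negbTE wn0) orbF subr_eq0 => /eqP.
Qed.

Lemma Jones_meets_closed (f : V -> R) (P : set V) (t : R) : Jones R n f ->
  closed P -> ~ countable P -> exists2 x, P x & f x = t.
Proof.
move=> Jf cP uP.
have [||x [Px fx]] := Jf (P `*` [set t]).
- have -> : P `*` [set t] = fst @^-1` P `&` snd @^-1` [set t] by [].
  apply: closedI.
    by apply: preimage_closed => // p _; exact: cvg_fst.
  by apply: preimage_closed; [move=> p _; exact: cvg_snd|exact: closed_eq].
- move=> cF; apply: uP; apply: sub_countable cF; apply: subset_card_le => x Px.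
  by exists (x, t).
by exists x.
Qed.

(* [{f <> 0}] and its complement both meet every uncountable closed set, so
   [{f <> 0}] is connected, but its image is [R \ {0}]. *)
Lemma Jones_not_Darboux (f : V -> R) : Jones R n f -> ~ Darboux R n f.
Proof.
move=> Jf Df; pose K := [set x | f x <> 0].
have cK : connected K.
  move=> B [b Bb] [W oW BW] [Z cZ BZ].
  apply: contrapT => BK.
  have [c [Kc nBc]] : exists c, K c /\ ~ B c.
    apply: contrapT => /forallNP Hn; apply: BK; apply/seteqP; split.
      by rewrite BW => x [].
    by move=> x Kx; apply: contrapT => nBx; apply: (Hn x).
  have oZ : open (~` Z) by exact: closed_openC.
  have KWZ x : K x -> W x -> ~ (~` Z) x.
    by move=> Kx Wx; apply; have [] : (K `&` Z) x by rewrite -BZ BW.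
  (* This open set misses [K]; were it nonempty, it would contain a closed ball, on which [f] takes
     the value 1. *)
  have WZ0 : W `&` ~` Z = set0.
    apply/seteqP; split => // x [Wx Zx].
    have /nbhs_ballP[e /= e0 eWZ] : nbhs x (W `&` ~` Z).
      by apply: open_nbhs_nbhs; split; [exact: openI|].
    have [||y /= yx fy] :=
      @Jones_meets_closed f [set y | `|y - x| <= e / 2] 1 Jf.
    - exact: closed_dist_le.
    - by apply: uncountable_closed_ball; rewrite divr_gt0.
    have [Wy Zy] : (W `&` ~` Z) y.
      apply: eWZ; rewrite -ball_normE/= distrC.
      by apply: le_lt_trans yx _; rewrite ltr_pdivrMr// ltr_pMr// ltr1n.
    by apply: KWZ Wy Zy; rewrite /K/= fy; apply/eqP; rewrite oner_eq0.
  (* A separation by [W] and the complement of [Z] leaves an uncountable closed set, which contains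
     a point of [K]; but these two sets cover [K]. *)
  have [||x nx fx] := @Jones_meets_closed f (~` (W `|` ~` Z)) 1 Jf.
  - by apply: open_closedC; exact: openU.
  - apply: countable_not_separating => //.
      by exists b; move: Bb; rewrite BW => -[].
    by exists c => Zc; apply: nBc; rewrite BZ.
  have Kx : K x by rewrite /K/= fx; apply/eqP; rewrite oner_eq0.
  apply: nx; have [Zx|] := pselect (Z x); last by right.
  by left; have [] : (K `&` W) x by rewrite -BW BZ.
have hit t : exists x, f x = t.
  have [||x _ fx] := @Jones_meets_closed f setT t Jf.
  - exact: closedT.
  - move=> cT; apply: (@uncountable_closed_ball 0 1 ltr01).
    by apply: sub_countable cT; exact: subset_card_le.
  by exists x.
have [x fx] := hit 1; have [y fy] := hit (-1).
have fKE t : (f @` K) t <-> t <> 0.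
  split; first by move=> [z Kz <-].
  by move=> t0; have [z fz] := hit t; exists z => //; rewrite /K/= fz.
(* As 0 is omitted, the negative part of the image is clopen in it. *)
have E := Df K cK (f @` K `&` [set t | t < 0]).
have : f @` K `&` [set t | t < 0] = f @` K.
  apply: E.
  - exists (-1); split => /=; last by rewrite oppr_lt0 ltr01.
    by apply/fKE/eqP; rewrite oppr_eq0 oner_eq0.
  - by exists [set t | t < 0] => //; exact: open_lt.
  - exists [set t | t <= 0]; first exact: closed_le.
    apply/seteqP; split => t [ft t0]; split => //=; first exact: ltW.
    by rewrite lt_neqAle t0 andbT; apply/eqP/fKE.
move=> /seteqP[_ /(_ 1)]; case; first by apply/fKE/eqP; rewrite oner_eq0.
by move=> _ /=; rewrite ltr10.
Qed.

End NotDarboux.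

(** * Spaceability and the value of $\mathcal{L}_p$ *)

Lemma ptws_spaceableS (R : realType) (n : nat) (M N : set ('rV[R]_n -> R)) mu :
  M `<=` N -> ptws_spaceable M mu -> ptws_spaceable N mu.
Proof.
move=> MN [V [Vs Vc Vd VM]]; exists V; split => //.
by apply: subset_trans VM _; apply: setSU.
Qed.

Theorem theorem4p5 (R : realType) (n : nat) (hn : (2 <= n)%N) :
  [/\ Jones R n `<=` almost_continuous R n `\` Darboux R n,
      ptws_spaceable (almost_continuous R n `\` Darboux R n) (set R)
    & exists K : Type,
        is_succ_card K (set R) /\
        is_Lp (almost_continuous R n `\` Darboux R n) K].
Proof.
have JAC : Jones R n `<=` almost_continuous R n `\` Darboux R n.
  move=> f Jf; split; first exact: Jones_almost_continuous.
  exact: Jones_not_Darboux.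
have sp := ptws_spaceableS JAC (Jones_spaceable R (ltnW hn)).
split => //; have [K KS] := ex_succ_card (set R); exists K; split => //; split.
  move=> mu Kmu [V [_ _ Vd _]]; apply: KS.1.2.
  by apply: card_le_trans Kmu _; exact: card_dim_le Vd.
(* A [C] injecting into [set R] is excluded by the closed space of dimension [set R], so [C] lies
   strictly above [set R]. *)
move=> C HC; apply: KS.2.
have nC : ~ ([set: C] #<= [set: set R]) by move=> CR; exact: HC CR sp.
by split => //; have [|//] := card_le_total (set R) C.
Qed.
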